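(* Real-amplitude quantum theory (RQT) coincides with the time-reversal-swirled quantum world. That is, for every (possibly composite) systems $S,S'$ with chosen orthonormal bases: (i) a Hermitian operator $O^S$ (state or effect) satisfies $\overline{O}^S=O^S$ if and only if it is time-reversal-invariant, $\mathcal{C}^S(O^S)=O^S$; and (ii) a quantum operation $\mathcal{E}^{S'|S}$ satisfies $\overline{\mathcal{E}}^{S'|S}=\mathcal{E}^{S'|S}$ if and only if it is time-reversal-covariant, $\mathcal{E}^{S'|S}\circ\mathcal{C}^S=\mathcal{C}^{S'}\circ\mathcal{E}^{S'|S}$.
   Context: For each elementary system $S$ fix an orthonormal basis of its finite-dimensional Hilbert space $\mathcal{H}^S$; composite systems use the product basis. $\overline{O}^S$ denotes the operator whose matrix elements in the chosen basis are the complex conjugates of those of $O^S$. A quantum operation $\mathcal{E}^{S'|S}$ is a completely positive trace-nonincreasing map from operators on $\mathcal{H}^S$ to operators on $\mathcal{H}^{S'}$; $\overline{\mathcal{E}}^{S'|S}$ denotes the superoperator whose Choi matrix elements (in the chosen bases) are the complex conjugates of those of $\mathcal{E}^{S'|S}$. RQT is the subtheory of quantum theory including all and only the states and effects $O^S$ with $\overline{O}^S=O^S$ and all and only the quantum operations with $\overline{\mathcal{E}}^{S'|S}=\mathcal{E}^{S'|S}$. Time-reversal symmetry is the representation of $\mathbb{Z}_2$ on each elementary system $S_i$ by $\{\mathbb{I}^{S_i},C^{S_i}\}$, where $C^{S_i}$ is the antilinear operator of complex conjugation in the chosen basis, $C^{S_i}\sum_a\psi_a|a\rangle=\sum_a\overline{\psi_a}|a\rangle$.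 On Hermitian operators it acts by $\mathcal{C}^{S_i}(O)=C^{S_i}O\,{C^{S_i}}^\dagger$, where the adjoint of an antilinear operator $C$ is defined by $\langle\eta|(C^\dagger|\psi\rangle)=\langle\psi|(C|\eta\rangle)$ for all vectors. On composite systems $S=S_1\cdots S_n$ it acts collectively: $\mathcal{C}^S(O)=C^SO\,{C^S}^\dagger$ with $C^S=C^{S_1}\otimes\cdots\otimes C^{S_n}$, complex conjugation in the product basis. The covariance condition in (ii) is understood as an equality of maps on Hermitian operators. The time-reversal-swirled quantum world is the subtheory of quantum theory whose states and effects are exactly the time-reversal-invariant ones and whose operations are exactly the time-reversal-covariant ones. *)

(* Defs.v *)
From HB Require Import structures.
From mathcomp Require Import all_boot all_order all_algebra.
From mathcomp Require Import boolp classical_sets reals.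
From mathcomp Require Export complex.

Set Implicit Arguments.
Unset Strict Implicit.
Unset Printing Implicit Defensive.

Import Order.TTheory GRing.Theory Num.Theory.

Local Open Scope classical_set_scope.
Local Open Scope ring_scope.

(* C^I, for a finite index type I. *)
Notation cspace R I := {ffun I -> R[i]^o}.

Section HilbertSpaces.
Variable R : realType.

(* Linear in the second argument, as in Dirac notation. *)
Definition braket (I : finType) (u v : cspace R I) : R[i] :=
  \sum_k (u k)^* * v k.

Definition delta (I : finType) (k : I) : cspace R I :=
  [ffun j => (j == k)%:R].

(* The operator |u><v|. *)
Definition ketbra (I J : finType) (u : cspace R I) (v : cspace R J) :
    'Hom(cspace R J, cspace R I) :=
  linfun (fun w : cspace R J => braket v w *: u).

Definition trace (I : finType) (O : 'End(cspace R I)) : R[i] :=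
  \sum_k braket (delta k) (O (delta k)).

Definition is_hermitian (I : finType) (O : 'End(cspace R I)) : Prop :=
  forall u v, braket u (O v) = braket (O u) v.

(* The order of R[i] makes 0 <= z say that z is real and nonnegative. *)
Definition psd (I : finType) (O : 'End(cspace R I)) : Prop :=
  forall u, 0 <= braket u (O u).

(* A^dagger psi is the unique vector phi with <eta|phi> = <psi|A eta> for all
   eta; it exists when A is antilinear (otherwise the value is 0). *)
Definition antiadjoint (I J : finType) (A : cspace R I -> cspace R J) :
    cspace R J -> cspace R I :=
  fun psi => xget (0 : cspace R I)
    [set phi | forall eta, braket eta phi = braket psi (A eta)].

End HilbertSpaces.

Section Systems.
Variable R : realType.

(* By dimension count, the orthonormal family is a basis of C^edim; it need not
   be the standard one. *)
Record elementary := Elementary {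
  edim : nat;
  ebasis : 'I_edim -> cspace R 'I_edim;
  ebasis_orthonormal : forall a b, braket (ebasis a) (ebasis b) = (a == b)%:R
}.

Record system := System {
  nfactors : nat;
  factor :> 'I_nfactors -> elementary
}.

(* Multi-indices (k_1, ..., k_n); C^(multi_index S) is the tensor product of the
   spaces C^(edim (S i)). *)
Definition multi_index (S : system) : finType :=
  {dffun forall i : 'I_(nfactors S), 'I_(edim (S i))}.

Notation operator S := 'End(cspace R (multi_index S)).
Notation superoperator S S' := 'Hom(operator S, operator S').

Definition tensor (S : system) (v : forall i, cspace R 'I_(edim (S i))) :
    cspace R (multi_index S) :=
  [ffun k : multi_index S => \prod_i v i (k i)].

(* The antilinear map sending tensor v to tensor (fun i => A i (v i)), for
   antilinear A i. *)
Definition antitensor (S : system)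
    (A : forall i, cspace R 'I_(edim (S i)) -> cspace R 'I_(edim (S i))) :
    cspace R (multi_index S) -> cspace R (multi_index S) :=
  fun psi => \sum_k (psi k)^* *: tensor (fun i => A i (delta R (k i))).

Definition pbasis (S : system) (a : multi_index S) :
    cspace R (multi_index S) :=
  tensor (fun i => ebasis (a i)).

Definition melem (S : system) (O : operator S) (a b : multi_index S) : R[i] :=
  braket (pbasis a) (O (pbasis b)).

Definition conj_op (S : system) (O : operator S) : operator S :=
  \sum_a \sum_b (melem O a b)^* *: ketbra (pbasis a) (pbasis b).

(* The matrix element <a' a| J |b' b> of the Choi operator
   J = \sum_(a, b) E(|a><b|) (x) |a><b|. *)
Definition choi (S S' : system) (E : superoperator S S')
    (a' : multi_index S') (a : multi_index S)
    (b' : multi_index S') (b : multi_index S) : R[i] :=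
  melem (E (ketbra (pbasis a) (pbasis b))) a' b'.

(* The superoperator with Choi matrix elements (choi E a' a b' b)^*, i.e. the
   linear map sending |a><b| to \sum_(a', b') (choi E a' a b' b)^* |a'><b'|. *)
Definition conj_superop (S S' : system) (E : superoperator S S') :
    superoperator S S' :=
  linfun (fun X : operator S =>
    \sum_a \sum_b \sum_a' \sum_b'
      (melem X a b * (choi E a' a b' b)^*) *: ketbra (pbasis a') (pbasis b')
    : operator S').

(* Operators on C^n (x) H are n x n blocks of operators on H, on which
   id (x) E acts blockwise. *)
Definition block_positive (S : system) (n : nat)
    (X : 'I_n -> 'I_n -> operator S) : Prop :=
  forall v : 'I_n -> cspace R (multi_index S),
    0 <= \sum_i \sum_j braket (v i) (X i j (v j)).

Definition completely_positive (S S' : system) (E : superoperator S S') :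
    Prop :=
  forall (n : nat) (X : 'I_n -> 'I_n -> operator S),
    block_positive X -> block_positive (fun i j => E (X i j)).

Definition trace_nonincreasing (S S' : system) (E : superoperator S S') :
    Prop :=
  forall X : operator S, psd X -> trace (E X) <= trace X.

Definition is_state (S : system) (O : operator S) : Prop :=
  psd O /\ trace O = 1.

Definition is_effect (S : system) (O : operator S) : Prop :=
  psd O /\ psd (\1%VF - O).

Definition quantum_operation (S S' : system) (E : superoperator S S') : Prop :=
  completely_positive E /\ trace_nonincreasing E.

Definition econj (s : elementary) (psi : cspace R 'I_(edim s)) :
    cspace R 'I_(edim s) :=
  \sum_a (braket (ebasis a) psi)^* *: ebasis a.

Definition sconj (S : system) :
    cspace R (multi_index S) -> cspace R (multi_index S) :=
  antitensor (fun i => @econj (S i)).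

(* The operator C O C^dagger, which is linear since C is antilinear. *)
Definition time_reversal (S : system) (O : operator S) : operator S :=
  linfun (fun psi : cspace R (multi_index S) =>
    sconj (O (antiadjoint (@sconj S) psi)) : cspace R (multi_index S)).

Definition time_reversal_invariant (S : system) (O : operator S) : Prop :=
  time_reversal O = O.

Definition time_reversal_covariant (S S' : system) (E : superoperator S S') :
    Prop :=
  forall O : operator S, is_hermitian O ->
    E (time_reversal O) = time_reversal (E O).

Record subtheory := Subtheory {
  states : forall S : system, set (operator S);
  effects : forall S : system, set (operator S);
  operations : forall S S' : system, set (superoperator S S')
}.

Definition RQT : subtheory := {|
  states := fun S => [set O | is_state O /\ conj_op O = O];
  effects := fun S => [set O | is_effect O /\ conj_op O = O];
  operations := fun S S' =>
    [set E | quantum_operation E /\ conj_superop E = E]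
|}.

Definition time_reversal_swirled : subtheory := {|
  states := fun S => [set O | is_state O /\ time_reversal_invariant O];
  effects := fun S => [set O | is_effect O /\ time_reversal_invariant O];
  operations := fun S S' =>
    [set E | quantum_operation E /\ time_reversal_covariant E]
|}.

End Systems.

Notation operator R S := 'End(cspace R (multi_index S)).
Notation superoperator R S S' := 'Hom(operator R S, operator R S').

(* Main.v *)
(** The collective conjugation [C] fixes every vector of the orthonormal product
    basis and is an antilinear involution equal to its own adjoint.  Hence the
    operator with conjugated matrix elements is exactly [C O C = C O C^dagger],
    and the superoperator with conjugated Choi matrix elements is [T o E o T],
    where [T O = C O C].  As [T] is an involution, [T o E o T = E] says that [E]
    commutes with [T].  Commutation on hermitian operators is enough, because
    [E o T] and [T o E] are both antilinear and the hermitian operators span. *)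

Require Import Defs.
From HB Require Import structures.
From mathcomp Require Import all_boot all_order all_algebra.
From mathcomp Require Import boolp classical_sets reals.

Set Implicit Arguments.
Unset Strict Implicit.
Unset Printing Implicit Defensive.

Import GRing.Theory Num.Theory.

Local Open Scope ring_scope.

(** Moving every inner sum to the tagged union of the [T i] gives a common index type, where
    ordinary distributivity applies; the families whose value at [i] has tag [i] are the dependent
    functions. *)
Lemma bigA_distr_dffun (K : comNzRingType) (I : finType) (T : I -> finType)
    (F : forall i, T i -> K) :
  \prod_i \sum_(j : T i) F i j =
  \sum_(f : {dffun forall i, T i}) \prod_i F i (f i).
Proof.
under eq_bigr => i _ do rewrite (big_tag (fun i => F i)).
rewrite bigA_distr_big_dep.
transitivity (\sum_(t : fprod T) \prod_i [ffun j => F i j] (t i)).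
  rewrite big_fprod; apply: eq_bigr => g _; apply: eq_bigr => i _.
  case: (g i) => j t; rewrite /untag /=; case: eqP => // e.
  by rewrite ffunE.
rewrite (reindex (@fprod_of_dffun _ T)); last exact/onW_bij/fprod_of_dffun_bij.
by apply: eq_bigr => f _; apply: eq_bigr => i _; rewrite ffunE fprodE.
Qed.

Lemma linfun_fun (K : fieldType) (U V : vectType K) (f : U -> V) :
  linear f -> linfun f =1 f.
Proof.
move=> f_lin.
pose fL : {linear U -> V} := HB.pack f (GRing.isLinear.Build K U V _ f f_lin).
exact: (lfunE fL).
Qed.

(** * Antilinear maps *)

Section Antilinear.
Variables (K : numClosedFieldType) (U V : lmodType K).

Definition antilinear (f : U -> V) : Prop :=
  forall a u v, f (a *: u + v) = a^* *: f u + f v.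

Variable f : U -> V.
Hypothesis f_anti : antilinear f.

Lemma antilinear0 : f 0 = 0.
Proof.
have := f_anti 1 0 0; rewrite scaler0 addr0 conjC1 scale1r => /esym/eqP.
by rewrite addrC -subr_eq0 addrK => /eqP.
Qed.

Lemma antilinearD u v : f (u + v) = f u + f v.
Proof. by have := f_anti 1 u v; rewrite conjC1 !scale1r. Qed.

Lemma antilinearZ a u : f (a *: u) = a^* *: f u.
Proof. by have := f_anti a u 0; rewrite antilinear0 !addr0. Qed.

Lemma antilinear_sum (I : finType) (F : I -> U) :
  f (\sum_i F i) = \sum_i f (F i).
Proof. exact: (big_morph f antilinearD antilinear0). Qed.

End Antilinear.

(** * The inner product and expansion in an orthonormal basis *)

Section Braket.
Variables (R : realType) (I : finType).
Implicit Types (u v w : cspace R I) (c : R[i]).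

Lemma cspaceD u v k : (u + v) k = u k + v k :> R[i].
Proof. by rewrite ffunE. Qed.

Lemma cspaceZ c u k : (c *: u) k = c * u k :> R[i].
Proof. by rewrite ffunE. Qed.

Lemma cspace_sum (J : finType) (F : J -> cspace R I) k :
  (\sum_j F j) k = \sum_j F j k :> R[i].
Proof. by rewrite sum_ffunE. Qed.

Lemma braket_linear c u v w :
  braket w (c *: u + v) = c * braket w u + braket w v.
Proof.
rewrite /braket mulr_sumr -big_split /=;
    apply: eq_bigr => k _.
by rewrite cspaceD cspaceZ mulrDr mulrCA.
Qed.

Lemma braketC u v : (braket u v)^* = braket v u.
Proof.
rewrite /braket rmorph_sum /=;
    apply: eq_bigr => k _.
by rewrite rmorphM /= conjCK mulrC.
Qed.

Lemma braket0r u : braket u 0 = 0.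
Proof. by rewrite /braket big1 // => k _; rewrite ffunE mulr0. Qed.

Lemma braketZr c u v : braket u (c *: v) = c * braket u v.
Proof. by have := braket_linear c v 0 u; rewrite braket0r !addr0. Qed.

Lemma braketDr u v w : braket u (v + w) = braket u v + braket u w.
Proof. by have := braket_linear 1 v w u; rewrite scale1r mul1r. Qed.

Lemma braket_sumr (J : finType) (F : J -> cspace R I) u :
  braket u (\sum_j F j) = \sum_j braket u (F j).
Proof.
exact: (big_morph _ (braketDr u) (braket0r u)).
Qed.

Lemma braketZl c u v : braket (c *: u) v = c^* * braket u v.
Proof. by rewrite -braketC braketZr rmorphM /= braketC. Qed.

Lemma braketDl u v w : braket (u + v) w = braket u w + braket v w.
Proof. by rewrite -braketC braketDr rmorphD /= !braketC. Qed.

Lemma braketBr u v w : braket u (v - w) = braket u v - braket u w.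
Proof. by rewrite -scaleN1r braketDr braketZr mulN1r. Qed.

Lemma braketBl u v w : braket (u - v) w = braket u w - braket v w.
Proof. by rewrite -braketC braketBr rmorphB /= !braketC. Qed.

Lemma braket_delta k u : braket (delta R k) u = u k.
Proof.
rewrite /braket (bigD1 k) //= big1 ?addr0 => [|j /negPf jk].
  by rewrite ffunE eqxx conjC1 mul1r.
by rewrite ffunE jk conjC0 mul0r.
Qed.

Lemma braket_inj u v : (forall w, braket w u = braket w v) -> u = v.
Proof. by move=> uv; apply/ffunP => k; rewrite -!braket_delta uv. Qed.

Lemma delta_expand u : u = \sum_k u k *: delta R k.
Proof.
apply/ffunP => j; rewrite cspace_sum (bigD1 j) //= big1 ?addr0 => [|k jk].
  by rewrite cspaceZ ffunE eqxx mulr1.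
by rewrite cspaceZ ffunE eq_sym (negPf jk) mulr0.
Qed.

(* An orthonormal family indexed by I is the family of rows of a square matrix
   M with M M^* = 1; then M^* M = 1 is the completeness relation. *)
Lemma orthonormal_expand (b : I -> cspace R I) :
  (forall i j, braket (b i) (b j) = (i == j)%:R) ->
  forall u, u = \sum_i braket (b i) u *: b i.
Proof.
move=> b_on u.
pose M : 'M[R[i]]_#|I| := \matrix_(i, k) (b (enum_val i) (enum_val k) : R[i]).
pose N : 'M[R[i]]_#|I| :=
  \matrix_(k, i) (b (enum_val i) (enum_val k) : R[i])^*.
have MN : M *m N = 1%:M.
  (* The (i, j) entry of [M *m N] is the bracket of the j-th vector with the i-th, hence the flip by
     [eq_sym]. *)
  apply/matrixP => i j; rewrite !mxE eq_sym -(inj_eq enum_val_inj) -b_on.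
  rewrite /braket [RHS](reindex _ (onW_bij _ (enum_val_bij I))) /=;
    apply: eq_bigr => k _.
  by rewrite !mxE mulrC.
have complete (j k : I) :
    \sum_i (b i j : R[i])^* * (b i k : R[i]) = (j == k)%:R.
  have /matrixP/(_ (enum_rank j) (enum_rank k)) := mulmx1C MN.
  rewrite !mxE (inj_eq enum_rank_inj) => <-.
  rewrite [LHS](reindex _ (onW_bij _ (enum_val_bij I))) /=;
    apply: eq_bigr => i _.
  by rewrite !mxE !enum_rankK.
apply/ffunP => k; rewrite cspace_sum.
transitivity (\sum_j (u j : R[i]) * \sum_i (b i j : R[i])^* * (b i k : R[i])).
  under eq_bigr do rewrite complete.
  rewrite (bigD1 k) //= big1 ?addr0 => [|j /negPf jk].
    by rewrite eqxx mulr1.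
  by rewrite jk mulr0.
under eq_bigr do rewrite mulr_sumr.
rewrite exchange_big /=;
    apply: eq_bigr => i _.
rewrite cspaceZ /braket mulr_suml; apply: eq_bigr => j _.
by rewrite mulrA [u j * _]mulrC.
Qed.

End Braket.

Lemma ketbraE (R : realType) (I J : finType) (u : cspace R I)
    (v w : cspace R J) :
  ketbra u v w = braket v w *: u.
Proof.
apply: linfun_fun => c x y.
by rewrite braket_linear scalerDl scalerA.
Qed.

Lemma braket_ketbra (R : realType) (I J : finType) (u x : cspace R I)
    (v w : cspace R J) :
  braket x (ketbra u v w) = braket (ketbra v u x) w.
Proof. by rewrite !ketbraE braketZr braketZl braketC mulrC. Qed.

(** * Complex conjugation relative to a basis *)

Section BasisConjugation.
Variables (R : realType) (I : finType) (b : I -> cspace R I).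

(** Common form of [econj], where [b] is [ebasis], and of [sconj], where [b] will be the product
    basis. *)
Definition basis_conj (u : cspace R I) : cspace R I :=
  \sum_i (braket (b i) u)^* *: b i.

Lemma basis_conj_antilinear : antilinear basis_conj.
Proof.
move=> c u v; rewrite /basis_conj scaler_sumr -big_split /=.
apply: eq_bigr => i _.
by rewrite braket_linear rmorphD rmorphM /= scalerDl scalerA.
Qed.

Lemma braket_basis_conj u v :
  braket u (basis_conj v) = braket v (basis_conj u).
Proof.
rewrite /basis_conj !braket_sumr; apply: eq_bigr => i _.
by rewrite !braketZr !braketC mulrC.
Qed.

(** By [braket_basis_conj] the conjugate of [u] meets the condition defining the adjoint, and
    nondegeneracy makes it the only such vector, so [xget] never returns its default 0. *)
Lemma antiadjoint_basis_conj : antiadjoint basis_conj = basis_conj.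
Proof.
apply/funext => u; rewrite /antiadjoint; apply: xget_unique => /=.
  by move=> v; exact: braket_basis_conj.
by move=> w w_adj; apply: braket_inj => v; rewrite w_adj braket_basis_conj.
Qed.

Hypothesis b_on : forall i j, braket (b i) (b j) = (i == j)%:R.

Lemma basis_conj_basis i : basis_conj (b i) = b i.
Proof.
rewrite /basis_conj (bigD1 i) //= big1 ?addr0 => [|j /negPf ji].
  by rewrite b_on eqxx conjC1 scale1r.
by rewrite b_on ji conjC0 scale0r.
Qed.

Lemma basis_conj_expand f : antilinear f ->
  (forall i, f (b i) = b i) -> f =1 basis_conj.
Proof.
move=> f_anti fb u; rewrite {1}(orthonormal_expand b_on u).
rewrite (antilinear_sum f_anti); apply: eq_bigr => i _.
by rewrite (antilinearZ f_anti) fb.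
Qed.

Lemma basis_conjK : involutive basis_conj.
Proof.
move=> u; rewrite [RHS](orthonormal_expand b_on u)
  [X in basis_conj X = _]/basis_conj.
rewrite (antilinear_sum basis_conj_antilinear); apply: eq_bigr => i _.
by rewrite (antilinearZ basis_conj_antilinear) conjCK basis_conj_basis.
Qed.

End BasisConjugation.

(** * Product bases, collective conjugation and time reversal of operators *)

Section Systems.
Variables (R : realType) (S : system R).

Lemma braket_tensor (u v : forall i, cspace R 'I_(edim (S i))) :
  braket (tensor u) (tensor v) = \prod_i braket (u i) (v i).
Proof.
rewrite /braket bigA_distr_dffun; apply: eq_bigr => k _.
by rewrite !ffunE rmorph_prod -big_split.
Qed.

Lemma pbasis_orthonormal (a b : multi_index S) :
  braket (pbasis a) (pbasis b) = (a == b)%:R.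
Proof.
rewrite braket_tensor; case: eqP => [->|/eqP ab].
  by rewrite big1 // => i _; rewrite ebasis_orthonormal eqxx.
have [i ab_i] : exists i, a i != b i.
  apply/existsP; rewrite -negb_forall; apply: contraNN ab => /forallP ab.
  by apply/eqP/ffunP => i; apply/eqP.
by rewrite (bigD1 i) //= ebasis_orthonormal (negPf ab_i) mul0r.
Qed.

Lemma antitensor_antilinear A : antilinear (@antitensor R S A).
Proof.
move=> c u v; rewrite /antitensor scaler_sumr -big_split /=.
apply: eq_bigr => k _.
by rewrite cspaceD cspaceZ rmorphD rmorphM /= scalerDl scalerA.
Qed.

(** Expanding each [v i] in the standard basis and multiplying out yields the sum that defines
    [antitensor]. This carries the definition, given on standard basis vectors, over to arbitrary
    chosen bases. *)
Lemma antitensor_tensor A (v : forall i, cspace R 'I_(edim (S i))) :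
  (forall i, antilinear (A i)) ->
  antitensor A (tensor v) = tensor (fun i => A i (v i)).
Proof.
move=> A_anti; apply/ffunP => j; rewrite cspace_sum ffunE.
have Av i : A i (v i) (j i) =
    \sum_k (v i k : R[i])^* * (A i (delta R k) (j i) : R[i]).
  rewrite {1}(delta_expand (v i)) (antilinear_sum (A_anti i)) cspace_sum.
  by apply: eq_bigr => k _; rewrite (antilinearZ (A_anti i)) cspaceZ.
under [RHS]eq_bigr do rewrite Av.
rewrite bigA_distr_dffun; apply: eq_bigr => k _.
by rewrite cspaceZ !ffunE rmorph_prod -big_split.
Qed.

(** Both sides are antilinear and fix the product basis: [antitensor] acts factorwise on [pbasis a],
    and each [econj] fixes its own basis vectors. *)
Lemma sconjE : @sconj R S = basis_conj (@pbasis R S).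
Proof.
apply/funext; apply: basis_conj_expand => [||a].
- exact: pbasis_orthonormal.
- exact: antitensor_antilinear.
rewrite /sconj antitensor_tensor => [|i]; last exact: basis_conj_antilinear.
congr tensor; apply: functional_extensionality_dep => i.
exact: basis_conj_basis (@ebasis_orthonormal R (S i)) (a i).
Qed.

Lemma sconj_antilinear : antilinear (@sconj R S).
Proof. exact: antitensor_antilinear. Qed.

Lemma sconjK : involutive (@sconj R S).
Proof. by rewrite sconjE; exact/basis_conjK/pbasis_orthonormal. Qed.

Lemma sconj_pbasis (a : multi_index S) : sconj (pbasis a) = pbasis a.
Proof. by rewrite sconjE (basis_conj_basis pbasis_orthonormal). Qed.

Lemma time_reversalE (O : operator R S) u :
  time_reversal O u = sconj (O (sconj u)).
Proof.
rewrite /time_reversal sconjE antiadjoint_basis_conj -sconjE.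
(* [linfun] agrees with its argument only once that is known to be linear; here the two conjugations
   of the scalar cancel. *)
apply: linfun_fun => c v w.
by rewrite sconj_antilinear linearP sconj_antilinear conjCK.
Qed.

Lemma operator_pbasisP (O P : operator R S) :
  (forall a, O (pbasis a) = P (pbasis a)) -> O = P.
Proof.
move=> OP; apply/lfunP => u.
rewrite (orthonormal_expand pbasis_orthonormal u) !linear_sum.
by apply: eq_bigr => a _; rewrite !linearZ /= OP.
Qed.

Lemma ketbra_pbasis (a b c : multi_index S) :
  ketbra (pbasis a) (pbasis b) (pbasis c) = (b == c)%:R *: pbasis a.
Proof. by rewrite ketbraE pbasis_orthonormal. Qed.

Lemma ketbra_sum_pbasis (m : multi_index S -> multi_index S -> R[i]) c :
  (\sum_a \sum_b m a b *: ketbra (pbasis a) (pbasis b)) (pbasis c) =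
  \sum_a m a c *: pbasis a.
Proof.
rewrite sum_lfunE; apply: eq_bigr => a _; rewrite sum_lfunE.
rewrite (bigD1 c) //= big1 ?addr0 => [|b /negPf bc].
  by rewrite scale_lfunE ketbra_pbasis eqxx scale1r.
by rewrite scale_lfunE ketbra_pbasis bc scale0r scaler0.
Qed.

Lemma melem_expand (O : operator R S) :
  O = \sum_a \sum_b melem O a b *: ketbra (pbasis a) (pbasis b).
Proof.
apply: operator_pbasisP => c; rewrite ketbra_sum_pbasis.
exact: orthonormal_expand pbasis_orthonormal _.
Qed.

(** On a basis vector the inner conjugation does nothing, and the outer one conjugates the
    coefficients of its image, which are a column of the matrix of [O]. *)
Lemma conj_opE (O : operator R S) : conj_op O = time_reversal O.
Proof.
apply: operator_pbasisP => c; rewrite ketbra_sum_pbasis time_reversalE.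
by rewrite sconj_pbasis sconjE.
Qed.

Lemma time_reversal_antilinear : antilinear (@time_reversal R S).
Proof.
move=> c O P; apply/lfunP => u.
rewrite add_lfunE scale_lfunE !time_reversalE add_lfunE scale_lfunE.
exact: sconj_antilinear.
Qed.

Lemma time_reversalK : involutive (@time_reversal R S).
Proof. by move=> O; apply/lfunP => u; rewrite !time_reversalE !sconjK. Qed.

Lemma time_reversal_ketbra (a b : multi_index S) :
  time_reversal (ketbra (pbasis a) (pbasis b)) = ketbra (pbasis a) (pbasis b).
Proof.
apply: operator_pbasisP => c.
rewrite time_reversalE sconj_pbasis ketbra_pbasis.
by rewrite (antilinearZ sconj_antilinear) sconj_pbasis rmorph_nat.
Qed.

End Systems.

(** * Conjugate superoperators and covariance *)

Section Superoperators.
Variables (R : realType) (S S' : system R).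
Implicit Type E : superoperator R S S'.

(** Expand [X] in matrix units, which time reversal fixes. Its coefficients are conjugated twice,
    hence restored, while the matrix of [E] on each unit, made of Choi elements, is conjugated
    once. *)
Lemma conj_superopE E X :
  conj_superop E X = time_reversal (E (time_reversal X)).
Proof.
rewrite /conj_superop linfun_fun => [|c Y Z].
  rewrite {2}(melem_expand X).
  rewrite (antilinear_sum (@time_reversal_antilinear R S)) linear_sum.
  rewrite (antilinear_sum (@time_reversal_antilinear R S')).
  apply: eq_bigr => a _.
  rewrite (antilinear_sum (@time_reversal_antilinear R S)) linear_sum.
  rewrite (antilinear_sum (@time_reversal_antilinear R S')).
  apply: eq_bigr => b _.
  rewrite (antilinearZ (@time_reversal_antilinear R S)) linearZ /=.
  rewrite (antilinearZ (@time_reversal_antilinear R S')) conjCK.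
  rewrite time_reversal_ketbra -conj_opE /conj_op scaler_sumr.
  apply: eq_bigr => a' _; rewrite scaler_sumr.
  by apply: eq_bigr => b' _; rewrite scalerA.
(* What remains is the linearity in [X] required by [linfun_fun]. *)
rewrite scaler_sumr -big_split /=; apply: eq_bigr => a _.
rewrite scaler_sumr -big_split /=; apply: eq_bigr => b _.
rewrite scaler_sumr -big_split /=; apply: eq_bigr => a' _.
rewrite scaler_sumr -big_split /=; apply: eq_bigr => b' _.
rewrite scalerA -scalerDl /melem add_lfunE scale_lfunE braket_linear.
by rewrite mulrDl mulrA.
Qed.

Lemma antilinear_hermitian_eq0 (f : operator R S -> operator R S') :
  antilinear f -> (forall O, is_hermitian O -> f O = 0) -> forall O, f O = 0.
Proof.
move=> f_anti f_herm O; rewrite (melem_expand O) (antilinear_sum f_anti).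
apply: big1 => a _; rewrite (antilinear_sum f_anti); apply: big1 => b _.
rewrite (antilinearZ f_anti).
set P := ketbra _ _; pose Q := ketbra (pbasis b) (pbasis a).
have PQ u v : braket u (P v) = braket (Q u) v by exact: braket_ketbra.
have QP u v : braket u (Q v) = braket (P u) v by exact: braket_ketbra.
(* P + Q and i (P - Q) are hermitian since Q is the adjoint of P. *)
have fPQ : f P + f Q = 0.
  rewrite -(antilinearD f_anti) f_herm // => u v.
  by rewrite !add_lfunE braketDr braketDl PQ QP addrC.
have fPNQ : f P - f Q = 0.
  have : f ('i *: (P - Q)) = 0.
    apply: f_herm => u v.
    rewrite !scale_lfunE braketZr braketZl conjCi mulNr -mulrN.
    by rewrite !add_lfunE !opp_lfunE braketBr braketBl PQ QP opprB.
  (* This puts [P - Q] in the shape that [f_anti] expands; the coefficient -1 is real and survives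
     conjugation. *)
  rewrite (antilinearZ f_anti) -scaleN1r addrC => /eqP.
  rewrite scaler_eq0 conjC_eq0 (negPf (neq0Ci _)) /= f_anti rmorphN1 => /eqP.
  by rewrite scaleN1r addrC.
move/eqP: fPQ; rewrite -(subr0_eq fPNQ) -mulr2n -scaler_nat scaler_eq0.
by rewrite pnatr_eq0 => /eqP ->; rewrite scaler0.
Qed.

(** The difference of the two sides is antilinear in [O], so [antilinear_hermitian_eq0] extends its
    vanishing from hermitian operators to all. *)
Lemma time_reversal_covariantP E :
  time_reversal_covariant E <->
  forall O, E (time_reversal O) = time_reversal (E O).
Proof.
split=> [E_cov O|E_cov O _]; last exact: E_cov.
apply/eqP; rewrite -subr_eq0; apply/eqP; move: O.
apply: antilinear_hermitian_eq0 => [c O P|O /E_cov ->]; last exact: subrr.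
rewrite time_reversal_antilinear !linearP time_reversal_antilinear.
by rewrite scalerBr opprD addrACA.
Qed.

Lemma conj_superop_covariantP E :
  conj_superop E = E <-> time_reversal_covariant E.
Proof.
rewrite time_reversal_covariantP; split=> [E_real O|E_cov].
  by rewrite -{2}E_real conj_superopE !time_reversalK.
by apply/lfunP => O; rewrite conj_superopE E_cov time_reversalK.
Qed.

End Superoperators.

Theorem mainTheorem4 (R : realType) :
  [/\ RQT R = time_reversal_swirled R,
      (forall (S : system R) (O : operator R S), is_hermitian O ->
         conj_op O = O <-> time_reversal_invariant O)
    & (forall (S S' : system R) (E : superoperator R S S'),
         quantum_operation E ->
         conj_superop E = E <-> time_reversal_covariant E)].
Proof.
(* Equalities of propositions, rather than equivalences, can be rewritten inside the sets that form
   a [subtheory]. *)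
have conj_invariantE S (O : operator R S) :
    (conj_op O = O) = time_reversal_invariant O by rewrite conj_opE.
have conj_covariantE S S' (E : superoperator R S S') :
    (conj_superop E = E) = time_reversal_covariant E.
  exact/propext/conj_superop_covariantP.
split=> [|S O _|S S' E _]; rewrite ?conj_invariantE ?conj_covariantE //.
congr Subtheory.
- apply: functional_extensionality_dep => S; apply/funext => O.
  by rewrite /= conj_invariantE.
- apply: functional_extensionality_dep => S; apply/funext => O.
  by rewrite /= conj_invariantE.
apply: functional_extensionality_dep => S.
apply: functional_extensionality_dep => S'; apply/funext => E.
by rewrite /= conj_covariantE.
Qed.
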